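(* Let $S=\kappa[x_1,\ldots,x_n]$, $n\ge 2$, be a polynomial ring over a field $\kappa$, and let $I$ be a nonzero proper monomial ideal of $S$ minimally generated by monomials $\mathbf{m}_1,\ldots,\mathbf{m}_q$. Suppose $\mathbf{v}\ne 1$ is a monomial in $S$. Then there are infinitely many monomials $\mathbf{m}\in S$ such that for all $j\ge 0$ $$\beta_j\big(S/(\mathbf{v}I+(\mathbf{m}))\big)=\begin{cases}\beta_j(S/I)+1 & \text{if } j\in\{1,2\}\text{ and } \mathbf{m}\nmid \mathbf{v}\mathbf{m}_i \text{ for all } i\in\{1,\ldots,q\},\\ \beta_j(S/I) & \text{otherwise.}\end{cases}$$
   Context: $\beta_j(S/J)$ denotes the $j$-th total Betti number of $S/J$, i.e. the rank of the $j$-th free module in a minimal (graded) free resolution of $S/J$ over $S$. *)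

(* Defs.v *)
From HB Require Import structures.
From mathcomp Require Import all_boot all_order all_algebra.
From mathcomp Require Import boolp classical_sets cardinality.
From mathcomp Require Import mpoly.

Set Implicit Arguments.
Unset Strict Implicit.
Unset Printing Implicit Defensive.

Import GRing.Theory.
Local Open Scope classical_set_scope.
Local Open Scope ring_scope.

Section Ideals.
Variables (K : fieldType) (n : nat).
Local Notation S := {mpoly K[n]}.

Definition ideal_gen (B : set S) : set S :=
  [set f | exists (r : nat) (c g : 'I_r -> S),
     (forall i, B (g i)) /\ f = \sum_(i < r) c i * g i].

Definition ideal_add (I J : set S) : set S :=
  [set f + g | f in I & g in J].

Definition ideal_scale (p : S) (I : set S) : set S := [set p * f | f in I].

(* A monomial of S is its exponent vector m : 'X_{1..n}; the corresponding
   polynomial is 'X_[m], the monomial 1 is 0%MM, products of monomials are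
   (m1 + m2)%MM and divisibility is the componentwise order (m1 <= m2)%MM. *)
Definition minimally_generated_by (I : set S) (q : nat)
    (ms : 'I_q -> 'X_{1..n}) : Prop :=
  I = ideal_gen [set 'X_[ms i] | i in setT] /\
  forall A : set 'I_q, I = ideal_gen [set 'X_[ms i] | i in A] -> A = setT.

Definition irrelevant_ideal : set S := ideal_gen [set 'X_i | i in setT].

Definition homogeneous_of_degree (d : int) (p : S) : bool :=
  if d is Posz k then p \is k.-homog else p == 0.

(* Data of a sequence  ... -> F_2 -> F_1 -> F_0 -> S  of graded free modules
   F_j = \bigoplus_a S(- shift j a), written with row vectors: the maps are
   u |-> u *m diff j : F_{j+1} -> F_j  and  u |-> u *m aug : F_0 -> S; the
   latter is to be read modulo the ideal J when resolving S/J. *)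
Record free_complex := FreeComplex {
  rk : nat -> nat;
  shift : forall j, 'I_(rk j) -> int;
  diff : forall j, 'M[S]_(rk j.+1, rk j);
  aug : 'cV[S]_(rk 0)
}.

Record minimal_graded_free_resolution (J : set S) (F : free_complex) : Prop := {
  aug_graded : forall a, homogeneous_of_degree (shift a) (aug F a 0);
  diff_graded : forall j a b,
    homogeneous_of_degree (shift a - shift b) (diff F j a b);
  aug_surjective : forall f : S, exists u : 'rV[S]_(rk F 0),
    J (f - (u *m aug F) 0 0);
  exact_at_0 : forall u : 'rV[S]_(rk F 0),
    J ((u *m aug F) 0 0) <-> exists w, u = w *m diff F 0;
  exact_at_succ : forall j (u : 'rV[S]_(rk F j.+1)),
    u *m diff F j = 0 <-> exists w, u = w *m diff F j.+1;
  diff_minimal : forall j a b, irrelevant_ideal (diff F j a b)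
}.

(* The j-th total Betti number of the S-module S/J. Minimal graded free
   resolutions of S/J exist and have the same ranks when J is a homogeneous
   ideal; the default value 0 is only reached for other sets J. *)
Definition betti (J : set S) (j : nat) : nat :=
  xget 0%N [set rk F j | F in minimal_graded_free_resolution J].

End Ideals.

(* Main.v *)
(* Pick a variable x_k dividing v and take m free of x_k but with large exponents
   in all other variables. Then (vI : m) is generated by a power p of x_k, so
   S/(vI + (m)) is resolved by the mapping cone of multiplication by m from
   0 -> S -> S, resolving S/(p), to the minimal resolution of S/vI, which has the
   ranks of that of S/I. The cone is minimal and adds one generator in
   homological degrees 1 and 2; infinitely many m are obtained by enlarging the exponents.
   Minimal graded resolutions exist by Dickson's lemma and the choice of
   homogeneous generating families of least size; their ranks are unique because
   comparison maps are invertible modulo the irrelevant ideal. *)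

From HB Require Import structures.
Require Import Defs.
From mathcomp Require Import all_boot all_order all_algebra.
From mathcomp Require Import boolp classical_sets cardinality.
From mathcomp Require Import mpoly.

Set Implicit Arguments.
Unset Strict Implicit.
Unset Printing Implicit Defensive.

Import Order.TTheory GRing.Theory Num.Theory.
Local Open Scope classical_set_scope.
Local Open Scope ring_scope.

(** * Submodules over a ring and factorization of matrices *)

Section Submodules.
Variable R : pzRingType.

Definition submodule (V : lmodType R) (N : set V) : Prop :=
  [/\ N 0, forall u w, N u -> N w -> N (u + w) & forall a u, N u -> N (a *: u)].

Lemma submoduleN (V : lmodType R) (N : set V) u : submodule N -> N u -> N (- u).
Proof. by case=> _ _ NZ Nu; rewrite -scaleN1r; apply: NZ. Qed.

Lemma submoduleB (V : lmodType R) (N : set V) u w :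
  submodule N -> N u -> N w -> N (u - w).
Proof. by move=> sN Nu Nw; case: (sN) => _ + _; apply=> //; apply: submoduleN. Qed.

Lemma submodule_sum (V : lmodType R) (N : set V) (T : Type) (s : seq T) (P : pred T) F :
  submodule N -> (forall i, P i -> N (F i)) -> N (\sum_(i <- s | P i) F i).
Proof. by case=> N0 ND _ NF; apply: (big_ind N). Qed.

Lemma submodule_mulmx (N : set R^o) m (u : 'rV[R]_m) (c : 'cV[R]_m) :
  submodule N -> (forall i, N (c i 0)) -> N ((u *m c) 0 0).
Proof.
move=> sN Nc; rewrite mxE; apply: (@submodule_sum R^o _) => // i _.
by case: sN => _ _ NZ; apply: (NZ (u 0 i) (c i 0)).
Qed.

(** Exactness is stated for single row vectors; choosing a preimage of each row turns it into a
    lifting property for matrices. *)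
Lemma rows_factor m p r (A : 'M[R]_(m, r)) (D : 'M[R]_(p, r)) :
  (forall i, exists w : 'rV_p, row i A = w *m D) -> exists B, A = B *m D.
Proof.
move=> /choice[w hw]; exists (\matrix_i w i).
by apply/row_matrixP => i; rewrite row_mul rowK.
Qed.

End Submodules.

(** * Constant terms and uniqueness of the ranks of minimal resolutions *)

Section ConstantTerm.
Variables (K : fieldType) (n : nat).
Local Notation S := {mpoly K[n]}.

Lemma ideal_gen_submodule (B : set S) : submodule (ideal_gen B : set S^o).
Proof.
split.
- by exists 0, (fun=> 0), (fun=> 0); split; [case | rewrite big_ord0].
- move=> _ _ [r [c [g [Bg ->]]]] [r' [c' [g' [Bg' ->]]]].
  pose glue (h : 'I_r -> S) (h' : 'I_r' -> S) i :=
    match split i with inl a => h a | inr a => h' a end.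
  exists (r + r')%N, (glue c c'), (glue g g'); split.
    by move=> i; rewrite /glue; case: (split i).
  rewrite big_split_ord /=; congr (_ + _); apply: eq_bigr => i _; rewrite /glue.
    by rewrite (unsplitK (inl i)).
  by rewrite (unsplitK (inr i)).
- move=> a _ [r [c [g [Bg ->]]]]; exists r, (fun i => a * c i), g; split=> //.
  by rewrite /GRing.scale /= mulr_sumr; apply: eq_bigr => i _; rewrite mulrA.
Qed.

Lemma mem_ideal_gen (B : set S) f : B f -> ideal_gen B f.
Proof.
by move=> Bf; exists 1, (fun=> 1), (fun=> f); rewrite big_ord1 mul1r.
Qed.

(** Every monomial other than 1 is a multiple of some variable. Minimality thus becomes a statement
    about matrices over [K]. *)
Lemma irrelevantP (f : S) : irrelevant_ideal f <-> f@_0 = 0.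
Proof.
split=> [[r [c [g [Xg ->]]]]|f0].
  rewrite raddf_sum big1// => i _; case: (Xg i) => k _ <-.
  by rewrite /= rmorphM /= mcoeffX mnm1_eq0 mulr0.
have sI := ideal_gen_submodule [set 'X_i | i in [set: 'I_n]].
rewrite (mpolyE f) big_seq; apply: (@submodule_sum _ S^o) => // m mf.
have [m0|] := eqVneq m 0%MM; first by rewrite -m0 in f0; rewrite mcoeff_msupp f0 eqxx in mf.
move=> m0; have [k mk] : exists k, (0 < m k)%N.
  apply/existsP; apply: contraNT m0; rewrite negb_exists => /forallP mk.
  by apply/eqP/mnmP => k; rewrite mnm0E; apply/eqP; rewrite -leqn0 leqNgt.
have -> : m = (m - U_(k) + U_(k))%MM by rewrite submK // lep1mP -lt0n.
rewrite mpolyXD scalerAl; case: sI => _ _ IZ; apply: (IZ _ 'X_k).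
by apply: mem_ideal_gen; exists k.
Qed.

Lemma irrelevant_map_mx p r (M : 'M[S]_(p, r)) :
  (forall a b, irrelevant_ideal (M a b)) -> map_mx (mcoeff 0%MM) M = 0.
Proof. by move=> hM; apply/matrixP => a b; rewrite !mxE; apply/irrelevantP. Qed.

(* Only the constant terms matter: a chain of comparison maps between two
   minimal resolutions is invertible modulo the irrelevant ideal. *)
Lemma minimal_resolution_rank_le (J : set S) (F G : free_complex K n) :
  submodule (J : set S^o) -> minimal_graded_free_resolution J F ->
  minimal_graded_free_resolution J G -> forall j, (rk F j <= rk G j)%N.
Proof.
move=> sJ rF rG.
have JB f g : J f -> J g -> J (f - g) by move=> ? ?; apply: (@submoduleB _ S^o).
have JD f g : J f -> J g -> J (f + g) by case: sJ => _ + _; apply.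
have d0 (E : free_complex K n) : minimal_graded_free_resolution J E ->
    forall j p (u : 'M_(p, _)), u *m diff E j.+1 *m diff E j = 0.
  move=> rE j p u; apply/row_matrixP => i; rewrite row_mul row0.
  by apply/(exact_at_succ rE); exists (row i u); rewrite row_mul.
have daug (E : free_complex K n) (rE : minimal_graded_free_resolution J E) i :
    J ((row i (diff E 0) *m aug E) 0 0).
  apply/(exact_at_0 rE); exists (delta_mx 0 i); rewrite -rowE //.
(* [A] and [B] are comparison maps in degree [j], and [H] is a homotopy from degree [j] to [j.+1].
   Multiplying by [diff F j] on the left kills the homotopy term coming from the preceding degree,
   so the third clause does not mention it. *)
pose Q j := exists (A : 'M[S]_(rk F j, rk G j)) B H,
  [/\ exists A', A' *m diff G j = diff F j *m A,
      exists B', B' *m diff F j = diff G j *m B,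
      diff F j *m (A *m B - 1%:M) = diff F j *m H *m diff F j
    & map_mx (mcoeff 0%MM) (A *m B - 1%:M) = 0].
have mF j : map_mx (mcoeff 0%MM) (diff F j) = 0.
  by apply: irrelevant_map_mx => a b; exact: (diff_minimal rF).
have Qj j : Q j.
  elim: j => [|j [A [B [H [[A' hA'] [B' hB'] hH _]]]]].
    have lift (E E' : free_complex K n) : minimal_graded_free_resolution J E ->
        minimal_graded_free_resolution J E' ->
        exists A : 'M_(rk E 0, rk E' 0), (forall i, J ((aug E - A *m aug E') i 0)) /\
          exists A', A' *m diff E' 0 = diff E 0 *m A.
      move=> rE rE'.
      have /choice[u hu] i := aug_surjective rE' (aug E i 0).
      have hA i : J ((aug E - (\matrix_i u i) *m aug E') i 0).
        have -> : (aug E - (\matrix_i u i) *m aug E') i 0 =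
            aug E i 0 - (u i *m aug E') 0 0 => //.
          rewrite !mxE; congr (_ - _); apply: eq_bigr => k _; by rewrite !mxE.
      exists (\matrix_i u i); split=> //.
      suff [A' ->] : exists A', diff E 0 *m (\matrix_i u i) = A' *m diff E' 0
        by exists A'.
      apply: rows_factor => i; apply/(exact_at_0 rE').
      have -> : row i (diff E 0 *m \matrix_i u i) *m aug E' = row i (diff E 0) *m aug E -
          row i (diff E 0) *m (aug E - (\matrix_i u i) *m aug E').
        by rewrite mulmxBr opprB addrCA subrr addr0 row_mul mulmxA.
      rewrite mxE [in X in _ + X]mxE; apply: JB; first exact: daug.
      exact: submodule_mulmx.
    have [A [hA [A' hA']]] := lift _ _ rF rG.
    have [B [hB [B' hB']]] := lift _ _ rG rF.
    (* In degree 0 the maps [A *m B] and [1%:M] agree modulo [J] after augmentation, so their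
       difference factors through [diff F 0]. *)
    have [H hH] : exists H, A *m B - 1%:M = H *m diff F 0.
      apply: rows_factor => i; apply/(exact_at_0 rF).
      rewrite rowE -mulmxA.
      have -> : (A *m B - 1%:M) *m aug F =
         - (A *m (aug G - B *m aug F) + (aug F - A *m aug G)).
        by rewrite mulmxBl mulmxBr mul1mx mulmxA addrAC addrCA subrr addr0 opprB.
      rewrite mulmxN mxE; apply: (@submoduleN _ S^o) => //.
      rewrite mulmxDr mulmxA mxE; apply: JD; exact: submodule_mulmx.
    exists A, B, H; split; [by exists A'|by exists B'|by rewrite hH mulmxA|].
    by rewrite hH map_mxM /= mF mulmx0.
  (* By the third clause of [Q], the left side is killed by [diff F j]; exactness supplies the next
     homotopy. *)
  have [H' hH'] : exists H', A' *m B' - 1%:M - diff F j *m H = H' *m diff F j.+1.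
    apply: rows_factor => i; apply/(exact_at_succ rF); rewrite -row_mul.
    rewrite !mulmxBl -mulmxA hB' mulmxA hA' -mulmxA -hH mul1mx mulmxBr mulmx1.
    by rewrite subrr row0.
  have eAB : A' *m B' - 1%:M = H' *m diff F j.+1 + diff F j *m H.
    by rewrite -hH' subrK.
  have lift (E E' : free_complex K n) : minimal_graded_free_resolution J E ->
      minimal_graded_free_resolution J E' ->
      forall A A', A' *m diff E' j = diff E j *m A ->
      exists A'', A'' *m diff E' j.+1 = diff E j.+1 *m A'.
    move=> rE rE' U U' hU.
    suff [X ->] : exists X, diff E j.+1 *m U' = X *m diff E' j.+1 by exists X.
    apply: rows_factor => i; apply/(exact_at_succ rE').
    rewrite -row_mul -mulmxA hU mulmxA.
    by rewrite -[diff E j.+1]mul1mx d0 // mul0mx row0.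
  exists A', B', H'; split.
  - exact: (lift _ _ rF rG _ _ hA').
  - exact: (lift _ _ rG rF _ _ hB').
  - rewrite eAB mulmxDr mulmxA [X in _ + X]mulmxA.
    by rewrite -[X in X *m diff F j]mul1mx d0 // mul0mx addr0.
  - by rewrite eAB map_mxD !map_mxM /= !mF mulmx0 mul0mx addr0.
(* Over [K] the product of the constant-term matrices is the identity of size [rk F j], and it
   factors through a space of dimension [rk G j]. *)
move=> j; have [A [B [_ [_ _ _ /eqP]]]] := Qj j.
rewrite map_mxB map_mxM map_mx1 subr_eq0 => /eqP AB1.
rewrite -(mxrank1 K (rk F j)) -AB1; apply: leq_trans (mxrankM_maxl _ _) _.
exact: rank_leq_col.
Qed.

Lemma betti_eq_rank (J : set S) (F : free_complex K n) j :
  submodule (J : set S^o) -> minimal_graded_free_resolution J F ->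
  betti J j = rk F j.
Proof.
move=> sJ rF; rewrite /betti; case: xgetP => [_ -> [G rG <-]|/(_ (rk F j))].
  by apply/eqP; rewrite eqn_leq; apply/andP; split; exact: (minimal_resolution_rank_le sJ).
by case; exists F.
Qed.

End ConstantTerm.

(** * Dickson's lemma and the Noetherian property *)

Lemma dickson n (P : set 'X_{1..n}) : exists s : seq 'X_{1..n},
  (forall m, m \in s -> P m) /\
  forall m, P m -> exists2 m', m' \in s & (m' <= m)%MM.
Proof.
pose basis (Q : set 'X_{1..n}) (s : seq 'X_{1..n}) := (forall m, m \in s -> Q m) /\
  forall m, Q m -> exists2 m', m' \in s & (m' <= m)%MM.
(* Induction on the number of coordinates that are not constant on Q. *)
suff main d (A : {set 'I_n}) (Q : set 'X_{1..n}) : (#|~: A| < d)%N ->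
    (forall m m' i, Q m -> Q m' -> i \in A -> m i = m' i) -> exists s, basis Q s.
  apply: (main _ finset.set0 _ (ltnSn _)) => m m' i _ _; by rewrite inE.
elim: d A Q => // d IH A Q ltA QA.
have [[a Qa]|Q0] := pselect (exists a, Q a); last first.
  by exists [::]; split=> // m Qm; case: Q0; exists m.
(* Fix [a] in [Q]. An element of [Q] that is not above [a] has some coordinate smaller than that of
   [a], so it lies in one of finitely many slices where a further coordinate is constant. The
   induction hypothesis applies to each slice. *)
have /choice[s hs] (x : 'I_n * 'I_(mdeg a)) : exists s, x.1 \notin A ->
    basis [set m | Q m /\ m x.1 = x.2] s.
  case: (boolP (x.1 \in A)) => xA; first by exists [::].
  have [||s hs] := IH (x.1 |: A) [set m | Q m /\ m x.1 = x.2]; last by exists s.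
    apply: leq_trans (_ : #|~: A| <= d)%N => //; apply: proper_card.
    rewrite properE finset.setCS finset.subsetUr /=; apply/subsetPn.
    by exists x.1; rewrite !inE ?xA // eqxx.
  move=> m m' i [Qm mx] [Qm' mx']; rewrite !inE => /orP[/eqP->|].
    by rewrite mx mx'.
  exact: QA.
exists (a :: flatten [seq s x | x <- enum [pred x | x.1 \notin A]]); split.
  move=> m; rewrite inE => /orP[/eqP->//|/flatten_mapP[x]].
  by rewrite mem_enum => xA /(proj1 (hs x xA))[].
move=> m Qm; have [am|] := boolP (a <= m)%MM.
  by exists a; rewrite ?mem_head.
move=> am; have [i mi] : exists i, (m i < a i)%N.
  apply: contrapT => mi; case/mnm_lepP: am => i.
  by rewrite leqNgt; apply/negP => ?; apply: mi; exists i.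
have iA : i \notin A.
  by apply: contraL mi => /(QA _ _ i Qm Qa) ->; rewrite ltnn.
have ma : (m i < mdeg a)%N.
  by apply: leq_trans mi _; rewrite mdegE (bigD1 i) //= leq_addr.
have [m' m's m'm] := proj2 (hs (i, Ordinal ma) iA) m (conj Qm erefl).
exists m' => //; rewrite inE; apply/orP; right; apply/flatten_mapP.
by exists (i, Ordinal ma) => //; rewrite mem_enum.
Qed.

Section Noetherian.
Variables (K : fieldType) (n : nat).
Local Notation S := {mpoly K[n]}.

Lemma mpolyX_neq0 m : 'X_[m] != 0 :> S.
Proof. by rewrite -msupp_eq0 msuppX. Qed.

(** Gröbner basis argument: finitely many leading monomials suffice by [dickson], and division by
    elements of [J] realizing them leaves remainder 0. *)
Lemma ideal_finitely_generated (J : set S) : submodule (J : set S^o) ->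
  exists k (g : 'cV[S]_k), forall f, J f <-> exists w : 'rV_k, f = (w *m g) 0 0.
Proof.
move=> sJ; have [_ JD JZ] := sJ.
have [s [sP sB]] := dickson [set m | exists f : S, [/\ J f, f != 0 & mlead f = m]].
have /choice[F hF] (i : 'I_(size s)) : exists f : S,
    [/\ J f, f != 0 & mlead f = tnth (in_tuple s) i].
  exact: (sP _ (mem_tnth i (in_tuple s))).
exists (size s), (\col_i F i) => f; split=> [|[w ->]]; last first.
  by apply: submodule_mulmx => // i; rewrite mxE; case: (hF i).
elim/mleadrect: f => f IH Jf; have [->|f0] := eqVneq f 0.
  by exists 0; rewrite mul0mx mxE.
have [_ /(nthP 0%MM)[j js <-]] := sB (mlead f) (ex_intro _ f (And3 Jf f0 erefl)).
pose i := Ordinal js; have [JF F0 mF] := hF i.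
rewrite -[nth _ _ _](tnth_nth _ (in_tuple s) i) -mF => le_m.
pose d := (mlead f - mlead (F i))%MM; pose a := mleadc f / mleadc (F i).
(* The multiple of [F i] is chosen to cancel the leading term of [f], so [q] is zero or has a
   smaller leading monomial. *)
pose q := f - a *: 'X_[d] * F i.
have mdF : mlead (a *: 'X_[d] * F i) = mlead f.
  have a0 : a != 0 by rewrite mulf_neq0 ?invr_eq0 ?mleadc_eq0.
  have dF0 : 'X_[d] * F i != 0 by rewrite mulf_neq0 // mpolyX_neq0.
  by rewrite -scalerAl mleadZ // mleadM ?mpolyX_neq0 // mleadXm submK.
have [w hw] : exists w : 'rV_(size s), q = (w *m \col_i F i) 0 0.
  have [->|q0] := eqVneq q 0; first by exists 0; rewrite mul0mx mxE.
  apply: IH; last by apply: (@submoduleB _ S^o) => //; apply: (JZ (a *: 'X_[d])).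
  rewrite lt_neqAle; apply/andP; split; last first.
    by apply: le_trans (mleadB_le _ _) _; rewrite mdF joinxx.
  apply/eqP => mq; move: q0; rewrite -mleadc_eq0 mq /q mcoeffB -scalerAl mcoeffZ.
  rewrite [_ * F i]mulrC -{2}(submK le_m) mcoeffMX.
  by rewrite /a divfK ?mleadc_eq0 // subrr eqxx.
exists (w + (a *: 'X_[d]) *: delta_mx 0 i).
rewrite mulmxDl -scalemxAl -rowE mxE -hw mxE !mxE.
by rewrite /q subrK.
Qed.

(** Induction on [r]: the first coordinates form an ideal, and the elements with first coordinate 0
    form a submodule of rank one less. Lifts of generators of the former, together with generators
    of the latter, generate [N]. *)
Lemma finitely_generated r (N : set 'rV[S]_r) : submodule N ->
  exists k (g : 'M[S]_(k, r)), forall u, N u <-> exists w, u = w *m g.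
Proof.
elim: r N => [|r IH] N sN; have [N0 ND NZ] := sN.
  exists 0, 0 => u; split=> _; first by exists 0; rewrite thinmx0 mul0mx.
  by rewrite thinmx0.
have [|k1 [g1 hg1]] := @ideal_finitely_generated
    [set f | exists u : 'rV_r, N (row_mx f%:M u : 'rV_(1 + r))].
  split=> [|f f' [u Nu] [u' Nu']|a f [u Nu]] /=.
  - by exists 0; rewrite raddf0 row_mx0.
  - by exists (u + u'); rewrite raddfD -add_row_mx; apply: ND.
  - by exists (a *: u); rewrite -[(a *: f)%:M]scale_scalar_mx -scale_row_mx; apply: NZ.
have [|k2 [g2 hg2]] := IH [set u | N (row_mx (0 : 'M_1) u : 'rV_(1 + r))].
  split=> [|u u' Nu Nu'|a u Nu] /=.
  - by rewrite row_mx0.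
  - by rewrite -[0]addr0 -add_row_mx; apply: ND.
  - by rewrite -(scaler0 _ a) -scale_row_mx; apply: NZ.
have /choice[U hU] i : exists u : 'rV_r, N (row_mx (g1 i 0)%:M u : 'rV_(1 + r)).
  by apply/hg1; exists (delta_mx 0 i); rewrite -rowE mxE.
pose V := \matrix_i U i; pose G : 'M_(k1 + k2, 1 + r) := block_mx g1 V 0 g2.
have NwV w : N (row_mx (w *m g1) (w *m V) : 'rV_(1 + r)).
  rewrite -mul_mx_row mulmx_sum_row; apply: (submodule_sum _ sN) => i _; apply: NZ.
  have -> : row i (row_mx g1 V) = row_mx (g1 i 0)%:M (U i) => //.
  by rewrite row_row_mx rowK [row i g1]mx11_scalar mxE.
have GE w1 w2 : row_mx w1 w2 *m G =
    row_mx (w1 *m g1) (w1 *m V) + row_mx (0 : 'M_1) (w2 *m g2) :> 'rV_(1 + r).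
  by rewrite /G mul_row_block mulmx0 !addr0 add_row_mx addr0.
exists (k1 + k2)%N, G => u; split=> [Nu|[w ->]]; last first.
  rewrite -[w]hsubmxK [X in N X]GE; apply: ND => //.
  by apply/hg2; exists (rsubmx w).
rewrite -[u](@hsubmxK _ 1 1 r) in Nu *.
move: (lsubmx _) (rsubmx _) Nu => f {}u Nu.
have [w1 hw1] : exists w : 'rV_k1, f 0 0 = (w *m g1) 0 0.
  by apply/(hg1 (f 0 0)); exists u; rewrite -mx11_scalar.
have {}hw1 : f = w1 *m g1 by rewrite [LHS]mx11_scalar hw1 -mx11_scalar.
have [w2 hw2] : exists w : 'rV_k2, u - w1 *m V = w *m g2.
  apply/hg2; suff: N (row_mx f u - row_mx (w1 *m g1) (w1 *m V) : 'rV_(1 + r)).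
    by rewrite opp_row_mx add_row_mx -hw1 subrr.
  exact: (submoduleB sN).
exists (row_mx w1 w2); rewrite [RHS]GE add_row_mx addr0 -hw1 -hw2.
by rewrite addrC subrK.
Qed.

End Noetherian.

(** * Homogeneous components and minimal homogeneous generators *)

Section Graded.
Variables (K : fieldType) (n : nat).
Local Notation S := {mpoly K[n]}.
Local Notation ofdeg := (@homogeneous_of_degree K n).

(** Degrees are integers so that differences of shifts can be formed without side conditions. *)
Definition hcomp (d : int) (p : S) : S :=
  if d is Posz k then pihomog mdeg k p else 0.

Lemma hcomp_is_linear d : linear (hcomp d).
Proof. by case: d => k a p q /=; rewrite ?linearP // scaler0 addr0. Qed.

HB.instance Definition _ d :=
  GRing.isLinear.Build K S S _ (hcomp d) (hcomp_is_linear d).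

Lemma homog0 d : ofdeg d 0.
Proof. by case: d => k /=; rewrite ?rpred0. Qed.

Lemma homogN d p : ofdeg d p -> ofdeg d (- p).
Proof. by case: d => k /=; rewrite ?rpredN ?oppr_eq0. Qed.

Lemma homogM d e p q : ofdeg d p -> ofdeg e q -> ofdeg (d + e) (p * q).
Proof.
case: d => k /=; last by move=> /eqP-> _; rewrite mul0r homog0.
by case: e => l /=; [apply: dhomogM | move=> _ /eqP->; rewrite mulr0 homog0].
Qed.

Lemma homogX m : ofdeg (mdeg m) 'X_[m].
Proof. by rewrite /= dhomogX. Qed.

Lemma hcomp_lt0 d p : d < 0 -> hcomp d p = 0.
Proof. by case: d. Qed.

Lemma hcomp_homog d p : ofdeg d (hcomp d p).
Proof. by case: d => k //=; apply: pihomogP. Qed.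

Lemma hcomp_id d p : ofdeg d p -> hcomp d p = p.
Proof. by case: d => k /=; [apply: pihomog_dE | move/eqP]. Qed.

Lemma hcomp_ne d e p : d != e -> ofdeg e p -> hcomp d p = 0.
Proof.
case: e => l; last by move=> _ /eqP->; rewrite raddf0.
by case: d => //= k kl; apply: pihomog_ne0; rewrite eq_sym.
Qed.

Lemma hcomp_sumE k (p : S) : (msize p <= k)%N -> p = \sum_(i < k) hcomp i p.
Proof. exact: pihomog_partitionE. Qed.

(** For homogeneous [p] both sides are [p * q] or 0 according to its degree; the general case
    follows by summing over components. *)
Lemma hcompM d e p q : ofdeg e q -> hcomp (d + e) (p * q) = hcomp d p * q.
Proof.
move=> hq; have hM (i : nat) : hcomp (d + e) (hcomp i p * q) = hcomp d (hcomp i p) * q.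
  have hpq := homogM (hcomp_homog i p) hq.
  have [->|di] := eqVneq d i; first by rewrite (hcomp_id (hcomp_homog i p)) hcomp_id.
  by rewrite (hcomp_ne _ hpq) ?(hcomp_ne di (hcomp_homog _ _)) ?mul0r // (inj_eq (addIr _)).
rewrite {1 2}(hcomp_sumE (leqnn (msize p))) mulr_suml !raddf_sum mulr_suml.
by apply: eq_bigr => i _; apply: hM.
Qed.

(** A nonzero constant term forces the degree to be 0, which excludes every other monomial. *)
Lemma homog_unit d p : ofdeg d p -> p@_0 != 0 -> p = (p@_0)%:MP.
Proof.
case: d => k; last by move=> /eqP->; rewrite mcoeff0 eqxx.
move=> /dhomogP hp; rewrite -mcoeff_msupp => /hp /=; rewrite mdeg0 => k0.
apply/mpolyP => m; rewrite mcoeffC; have [->|m0] := eqVneq m 0%MM; first by rewrite mulr1.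
rewrite mulr0; apply/eqP; rewrite mcoeff_eq0; apply: contra m0 => /hp /=.
by rewrite -k0 => /eqP; rewrite mdeg_eq0.
Qed.

(** This is the component of degree [d] in the direct sum of the twists $S(-s_b)$. *)
Definition rcomp r (s : 'I_r -> nat) (d : nat) (u : 'rV[S]_r) : 'rV[S]_r :=
  \row_b hcomp (d%:Z - (s b)%:Z) (u 0 b).

Definition graded r (s : 'I_r -> nat) (N : set 'rV[S]_r) :=
  forall d u, N u -> N (rcomp s d u).

Definition homog_row r (s : 'I_r -> nat) (d : nat) (u : 'rV[S]_r) :=
  forall b, ofdeg (d%:Z - (s b)%:Z) (u 0 b).

Lemma rcomp_homog r (s : 'I_r -> nat) d u : homog_row s d (rcomp s d u).
Proof. by move=> b; rewrite mxE hcomp_homog. Qed.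

Lemma rcomp_mulmx r k (s : 'I_r -> nat) (t : 'I_k -> nat) (D : 'M_(k, r)) d w :
  (forall a, homog_row s (t a) (row a D)) ->
  rcomp s d (w *m D) = rcomp t d w *m D.
Proof.
move=> hD; apply/rowP => b; rewrite !mxE raddf_sum; apply: eq_bigr => a _.
have := hD a b; rewrite !mxE => hDab; rewrite -(hcompM _ _ hDab); congr (hcomp _ _).
by rewrite addrA subrK.
Qed.

Lemma rcomp_sumE r (s : 'I_r -> nat) (u : 'rV[S]_r) :
  exists B, u = \sum_(d < B) rcomp s d u.
Proof.
exists (\max_b (s b + msize (u 0%R b)))%N; set B := (\max_b _)%N.
apply/rowP => b; rewrite summxE.
(* For a fixed coordinate [b], indices below [s b] give negative degrees and contribute nothing; the
   remaining ones cover all degrees occurring in [u 0 b]. *)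
have hB : (s b + msize (u 0%R b) <= B)%N by apply: (leq_bigmax_cond (F := fun b => _)).
have -> : B = (s b + (B - s b))%N by rewrite subnKC // (leq_trans _ hB) // leq_addr.
rewrite big_split_ord /= big1 ?add0r => [|i _]; last first.
  by rewrite mxE hcomp_lt0 // subr_lt0 ltz_nat /=.
rewrite {1}(@hcomp_sumE (B - s b) (u 0 b)); last by rewrite leq_subRL // (leq_trans _ hB) // leq_addr.
by apply: eq_bigr => i _; rewrite mxE /= PoszD addrAC subrr add0r.
Qed.

Definition homog_generators r (s : 'I_r -> nat) (N : set 'rV[S]_r)
    k (t : 'I_k -> nat) (D : 'M[S]_(k, r)) :=
  (forall a, homog_row s (t a) (row a D)) /\
  forall u, N u <-> exists w, u = w *m D.

(** The components of finitely many generators lie in [N] because [N] is graded, and they sum to the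
    generators. *)
Lemma homog_generators_exist r (s : 'I_r -> nat) (N : set 'rV[S]_r) :
  submodule N -> graded s N ->
  exists k (t : 'I_k -> nat) D, homog_generators s N t D.
Proof.
move=> sN gN; have [k [g hg]] := finitely_generated sN.
have /choice[B hB] a := rcomp_sumE s (row a g).
pose T : finType := ('I_k * 'I_(\max_a B a))%type.
pose D := \matrix_(x < #|T|) rcomp s (enum_val x).2 (row (enum_val x).1 g).
exists #|T|, (fun x : 'I_#|T| => nat_of_ord (enum_val x).2), D; split.
  by move=> x; rewrite rowK; apply: rcomp_homog.
have Ng a : N (row a g) by apply/hg; exists (delta_mx 0 a); rewrite rowE.
have ND w : N (w *m D).
  rewrite mulmx_sum_row; apply: (submodule_sum _ sN) => x _.
  by case: sN => _ _; apply; rewrite rowK; apply: gN.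
move=> u; split=> [|[w ->]//]; move=> /hg[w ->].
suff [C ->] : exists C, g = C *m D by exists (w *m C); rewrite mulmxA.
apply: rows_factor => a.
exists (\sum_(d < B a) delta_mx 0 (enum_rank (a, widen_ord (leq_bigmax a) d))).
rewrite mulmx_suml [LHS]hB; apply: eq_bigr => d _.
by rewrite -rowE rowK enum_rankK.
Qed.

(* A relation with a unit coefficient would express one generator through the
   others, so a generating family of least size has only non-unit relations. *)
Lemma minimal_homog_generators r (s : 'I_r -> nat) (N : set 'rV[S]_r) :
  submodule N -> graded s N ->
  exists k (t : 'I_k -> nat) D, homog_generators s N t D /\
    forall d w, w *m D = 0 -> homog_row t d w -> forall b, irrelevant_ideal (w 0 b).
Proof.
move=> sN gN; pose P k := `[< exists (t : 'I_k -> nat) D, homog_generators s N t D >].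
have exP : exists k, P k.
  by have [k hk] := homog_generators_exist sN gN; exists k; apply/asboolP.
have [k /asboolP[t [D [hD DN]]] kmin] := ex_minnP exP.
exists k, t, D; split=> // d w wD hw b; apply/irrelevantP; apply: contrapT => /eqP wb.
have {hw} wbE := homog_unit (hw b) wb.
case: k => [|k] in t D hD DN w wD b wb wbE kmin *; first by case: b {wb wbE}.
suff /kmin : P k by rewrite ltnn.
apply/asboolP; exists (t \o lift b), (row' b D); split=> [a|u].
  by move=> c; have := hD (lift b a) c; rewrite !mxE.
have row'E (x : 'rV[S]_k.+1) : x 0 b = 0 -> x *m D = col' b x *m row' b D.
  move=> xb; apply/rowP => c; rewrite !mxE (bigD1_ord b) //= xb mul0r add0r.
  by apply: eq_bigr => a _; rewrite !mxE.
rewrite DN; split=> [[x ->]|[x ->]].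
  (* Subtracting a multiple of the relation [w] leaves [x *m D] unchanged; the multiple is chosen to
     clear coordinate [b], where [w] is an invertible constant. *)
  pose y := x - (x 0 b * ((w 0 b)@_0)^-1%:MP) *: w.
  exists (col' b y); rewrite -row'E.
    by rewrite mulmxBl -scalemxAl wD scaler0 subr0.
  by rewrite !mxE -mulrA {2}wbE -mpolyCM mulVf // mulr1 subrr.
pose y : 'rV_k.+1 := \row_a if unlift b a is Some a' then x 0 a' else 0.
exists y; rewrite row'E; last by rewrite mxE unlift_none.
by congr (_ *m _); apply/rowP => a; rewrite !mxE liftK.
Qed.

End Graded.

(** * Existence of minimal graded free resolutions *)

Section IdealResolutions.
Variables (K : fieldType) (n : nat).
Local Notation S := {mpoly K[n]}.
Local Notation ofdeg := (@homogeneous_of_degree K n).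

(* A minimal graded free resolution of S/J with F_0 = S and identity augmentation, with
   the two leftmost terms split off: the rows of d0 generate J. *)
Record ideal_resolution (J : set S) (r : nat -> nat) (sh : forall j, 'I_(r j) -> int)
    (d0 : 'cV[S]_(r 0)) (d : forall j, 'M[S]_(r j.+1, r j)) : Prop := {
  gen_graded : forall a, ofdeg (sh 0%N a) (d0 a 0);
  syz_graded : forall j a b, ofdeg (sh j.+1 a - sh j b) (d j a b);
  gen_span : forall f, J f <-> exists w : 'rV_(r 0%N), f = (w *m d0) 0 0;
  gen_exact : forall u : 'rV_(r 0), u *m d0 = 0 <-> exists w : 'rV_(r 1%N), u = w *m d 0%N;
  syz_exact : forall j (u : 'rV_(r j.+1)),
    u *m d j = 0 <-> exists w : 'rV_(r j.+2), u = w *m d j.+1;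
  gen_minimal : forall a, irrelevant_ideal (d0 a 0);
  syz_minimal : forall j a b, irrelevant_ideal (d j a b)
}.

Definition cyclic_complex (r : nat -> nat) (sh : forall j, 'I_(r j) -> int)
    (d0 : 'cV[S]_(r 0)) (d : forall j, 'M[S]_(r j.+1, r j)) : free_complex K n :=
  @FreeComplex K n (fun j => if j is j'.+1 then r j' else 1)
    (fun j => match j with 0 => fun=> 0 | j'.+1 => @sh j' end)
    (fun j => match j with 0 => d0 | j'.+1 => d j' end) 1%:M.

Lemma cyclic_complexP J r sh d0 d : submodule (J : set S^o) ->
  @ideal_resolution J r sh d0 d ->
  minimal_graded_free_resolution J (cyclic_complex sh d0 d).
Proof.
move=> sJ R; have [J0 _ _] := sJ; split=> /=.
- by move=> a; rewrite (ord1 a) mxE eqxx /= dhomog1.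
- case=> [|j] a b; last exact: (syz_graded R).
  by rewrite subr0 ord1; apply: (gen_graded R).
- by move=> f; exists f%:M; rewrite mulmx1 mxE eqxx mulr1n subrr.
- move=> u; rewrite mulmx1 (gen_span R); split=> -[w hw]; exists w.
    by rewrite [LHS]mx11_scalar [RHS]mx11_scalar hw.
  by rewrite hw.
- by case=> [|j] u; [apply: (gen_exact R) | apply: (syz_exact R)].
- by case=> [|j] a b; [rewrite ord1; apply: (gen_minimal R) | apply: (syz_minimal R)].
Qed.

Lemma betti_ideal_resolution J r sh d0 d : submodule (J : set S^o) ->
  @ideal_resolution J r sh d0 d ->
  forall j, betti J j = if j is j'.+1 then r j' else 1%N.
Proof. by move=> sJ /(cyclic_complexP sJ) R j; rewrite (betti_eq_rank j sJ R). Qed.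

(** One step of the construction: a free module with generators in given degrees, and the submodule
    still to be resolved. The closure properties are kept apart in [graded_stage], so that the
    passage to the next stage is a total function that can be iterated. *)
Record stage := Stage {
  stage_rk : nat;
  stage_shift : 'I_stage_rk -> nat;
  stage_mod : set 'rV[S]_stage_rk
}.

Arguments stage_shift : clear implicits.
Arguments stage_mod : clear implicits.

Definition graded_stage (X : stage) :=
  submodule (stage_mod X) /\ graded (stage_shift X) (stage_mod X).

Definition syzygies k r (t : 'I_k -> nat) (D : 'M[S]_(k, r)) :=
  Stage t [set w | w *m D = 0].

Lemma syzygies_graded k r (s : 'I_r -> nat) (t : 'I_k -> nat) (D : 'M[S]_(k, r)) :
  (forall a, homog_row s (t a) (row a D)) -> graded_stage (syzygies t D).
Proof.
move=> hD; split=> [|d w /= wD]; last by rewrite -(rcomp_mulmx _ _ hD) wD;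
  apply/rowP => b; rewrite !mxE raddf0.
split=> [|u w /= uD wD|a u /= uD]; first exact: mul0mx.
  by rewrite mulmxDl uD wD addr0.
by rewrite -scalemxAl uD scaler0.
Qed.

(** Starting from [I] inside a free module of rank 1, minimal homogeneous generators are chosen and
    replaced by their syzygies, over and over. *)
Lemma ideal_resolution_exists (I : set S) :
  submodule (I : set S^o) -> (forall d f, I f -> I (hcomp d f)) -> I <> setT ->
  exists r sh d0 d, @ideal_resolution I r sh d0 d.
Proof.
move=> sI gI properI.
(* A stage that is not graded receives the empty family as a default. *)
have /(_ _)/cid-/all_sig[G hG] (X : stage) :
    exists Y : {k & (('I_k -> nat) * 'M[S]_(k, stage_rk X))%type}, graded_stage X ->
      homog_generators (stage_shift X) (stage_mod X) (tagged Y).1 (tagged Y).2 /\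
      forall d w, w *m (tagged Y).2 = 0 -> homog_row (tagged Y).1 d w ->
        forall b, irrelevant_ideal (w 0 b).
  have [[sN gN]|nX] := pselect (graded_stage X); last first.
    by exists (existT _ 0%N (fun=> 0%N, 0)).
  have [k [t [D hD]]] := minimal_homog_generators sN gN.
  by exists (existT _ k (t, D)).
pose next X := syzygies (tagged (G X)).1 (tagged (G X)).2.
pose X0 := @Stage 1 (fun=> 0%N) [set u | I (u 0 0)].
pose st j := iter j next X0.
have gst j : graded_stage (st j).
  elim: j => [|j /hG[[hD _] _]]; last exact: syzygies_graded.
  have [I0 ID IZ] := sI; split=> [|d u /= Iu]; last by rewrite mxE; apply: gI.
  split=> [|u w /= Iu Iw|a u /= Iu]; rewrite /= mxE //; first exact: ID.
  exact: IZ.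
pose D j : 'M_(stage_rk (st j.+1), stage_rk (st j)) := (tagged (G (st j))).2.
have shE j a b : ofdeg ((stage_shift (st j.+1) a)%:Z - (stage_shift (st j) b)%:Z) (D j a b).
  by have [[+ _] _] := hG _ (gst j) => /(_ a b); rewrite mxE.
have exD j (u : 'rV_(stage_rk (st j))) : stage_mod (st j) u <-> exists w, u = w *m D j.
  by have [[_ ->] _] := hG _ (gst j).
pose d0 : 'cV_(stage_rk (st 1)) := D 0%N.
exists (fun j => stage_rk (st j.+1)), (fun j a => (stage_shift (st j.+1) a)%:Z),
  d0, (fun j => D j.+1).
have IE f : I f <-> exists w : 'rV_(stage_rk (st 1)), f = (w *m d0) 0 0.
  have := exD 0%N f%:M; rewrite /= mxE eqxx mulr1n => ->.
  split=> -[w hw]; exists w; first by rewrite -hw mxE eqxx mulr1n.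
  by rewrite hw -mx11_scalar.
split=> //.
- by move=> a; have := shE 0%N a 0; rewrite subr0.
- by move=> u; apply: (exD 1%N).
- by move=> j u; apply: (exD j.+2).
(* A homogeneous generator with nonzero constant term is a unit, which would make [I] the whole
   ring. *)
- move=> a; apply/irrelevantP; apply: contrapT => /eqP Da.
  have Ia : I (d0 a 0) by apply/IE; exists (delta_mx 0 a); rewrite -rowE mxE.
  apply: properI; apply/seteqP; split=> // f _.
  have [_ _ IZ] := sI; have := IZ (f * ((d0 a 0)@_0)^-1%:MP) _ Ia.
  by rewrite {2}(homog_unit (shE 0%N a 0) Da) /GRing.scale /= -mulrA -mpolyCM mulVf // mulr1.
(* Each row of [D j.+1] is a homogeneous relation among the generators chosen before, and such
   relations have no unit coefficient. *)
- move=> j a b; have [_ hmin] := hG _ (gst j).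
  have <- : row a (D j.+1) 0 b = D j.+1 a b by rewrite mxE.
  apply: (hmin (stage_shift (st j.+2) a)).
    by apply: (proj2 (exD j.+1 _)); exists (delta_mx 0 a); rewrite -rowE.
  by move=> c; rewrite mxE; apply: shE.
Qed.
End IdealResolutions.

(** * The mapping cone that adjoins a monomial *)

Section Cone.
Variables (K : fieldType) (n : nat).
Local Notation S := {mpoly K[n]}.
Local Notation ofdeg := (@homogeneous_of_degree K n).

Lemma ideal_gen1 (g f : S) : ideal_gen [set g] f <-> exists c, f = c * g.
Proof.
split=> [[r [c [h [hg ->]]]]|[c ->]].
  by exists (\sum_i c i); rewrite mulr_suml; apply: eq_bigr => i _; rewrite (hg i).
by exists 1, (fun=> c), (fun=> g); rewrite big_ord1.
Qed.

Lemma ideal_add_submodule (I J : set S) : submodule (I : set S^o) ->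
  submodule (J : set S^o) -> submodule (ideal_add I J : set S^o).
Proof.
move=> [I0 ID IZ] [J0 JD JZ]; split.
- by exists 0 => //; exists 0 => //; rewrite addr0.
- move=> _ _ [f If [g Jg <-]] [f' If' [g' Jg' <-]].
  exists (f + f'); first exact: ID; exists (g + g'); first exact: JD.
  by rewrite addrACA.
- move=> a _ [f If [g Jg <-]]; exists (a * f); first exact: IZ.
  by exists (a * g); [exact: JZ | rewrite scalerDr].
Qed.

Lemma ideal_scale_submodule (p : S) (I : set S) : submodule (I : set S^o) ->
  submodule (ideal_scale p I : set S^o).
Proof.
move=> [I0 ID IZ]; split.
- by exists 0; rewrite ?mulr0.
- move=> _ _ [f If <-] [g Ig <-]; exists (f + g); first exact: ID.
  by rewrite mulrDr.
- by move=> a _ [f If <-]; exists (a * f); [exact: IZ | rewrite mulrCA].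
Qed.

(** Index [j] stands for homological degree [j.+1], so the extra summands sit in homological degrees
    1 and 2. *)
Definition cone_rk (r : nat -> nat) j := (if (j < 2)%N then r j + 1 else r j)%N.

(* Mapping cone of the multiplication S/(p) -> S/vI by m, where (p) = (vI : m):
   p m = v (c *m d0) says that c lifts it to the first syzygies. *)
Lemma cone_resolution (I : set S) r sh d0 d (v m p : 'X_{1..n}) (c : 'rV[S]_(r 0%N)) :
  submodule (I : set S^o) -> @ideal_resolution K n I r sh d0 d ->
  m != 0%MM -> p != 0%MM ->
  'X_[p] * 'X_[m] = 'X_[v] * (c *m d0) 0 0 ->
  (forall b, ofdeg ((mdeg p)%:Z + (mdeg m)%:Z - (sh 0%N b + (mdeg v)%:Z)) (c 0 b)) ->
  (forall b, irrelevant_ideal (c 0 b)) ->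
  (forall u f, I f -> u * 'X_[m] = 'X_[v] * f -> exists w, u = w * 'X_[p]) ->
  exists sh' d0' d', @ideal_resolution K n
    (ideal_add (ideal_scale 'X_[v] I) (ideal_gen [set 'X_[m]]))
    (cone_rk r) sh' d0' d'.
Proof.
move=> sI R m0 p0 pmE hc irr_c colon.
have X0 (q : 'X_{1..n}) : 'X_[q] != 0 :> S by apply: mpolyX_neq0.
have irrX (q : 'X_{1..n}) : q != 0%MM -> irrelevant_ideal ('X_[q] : S).
  by move=> q0; apply/irrelevantP; rewrite mcoeffX (negbTE q0).
have irrZ (a f : S) : irrelevant_ideal f -> irrelevant_ideal (a * f).
  by move=> /irrelevantP f0; apply/irrelevantP; rewrite rmorphM /= f0 mulr0.
have irr0 : irrelevant_ideal (0 : S) by apply/irrelevantP; rewrite mcoeff0.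
have ofdegE (e e' : int) f : e = e' -> ofdeg e f -> ofdeg e' f by move=> ->.
pose V := (mdeg v)%:Z; pose M := (mdeg m)%:Z; pose P := (mdeg p)%:Z.
(* Multiplication by ['X_[v]] moves the old degrees by [V]. The new generator ['X_[m]] has degree
   [M], and its new syzygy has degree [P + M]. *)
pose sh' j : 'I_(cone_rk r j) -> int :=
  match j return 'I_(cone_rk r j) -> int with
  | 0 => fun a => match split a with inl a => sh 0%N a + V | inr _ => M end
  | 1 => fun a => match split a with inl a => sh 1%N a + V | inr _ => P + M end
  | j'.+2 => fun a => sh j'.+2 a + V
  end.
pose d0' : 'cV[S]_(cone_rk r 0) := col_mx ('X_[v] *: d0) 'X_[m]%:M.
(* The last row of the block matrix, [c] followed by [- 'X_[p]], is the syzygy expressing that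
   ['X_[p] * 'X_[m]] lies in vI. *)
pose d' j : 'M[S]_(cone_rk r j.+1, cone_rk r j) :=
  match j return 'M[S]_(cone_rk r j.+1, cone_rk r j) with
  | 0 => block_mx (d 0%N) 0 c (- 'X_[p])%:M
  | 1 => row_mx (d 1%N) 0
  | j'.+2 => d j'.+2
  end.
have M00 (e : S) : (e%:M : 'M_1) 0 0 = e by rewrite mxE eqxx mulr1n.
have d0'E w e : ((row_mx w e : 'rV_(r 0%N + 1)) *m d0') 0 0 =
    'X_[v] * (w *m d0) 0 0 + e 0 0 * 'X_[m].
  rewrite /d0' mul_row_col [LHS]mxE -scalemxAr [X in X + _]mxE; congr (_ + _).
  by rewrite [e in LHS]mx11_scalar -scalar_mxM mxE eqxx mulr1n.
have splitR k (u : 'rV[S]_(k + 1)) : exists w e, u = row_mx w e.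
  by exists (lsubmx u), (rsubmx u); rewrite hsubmxK.
exists sh', d0', d'; split.
- move=> a; rewrite /sh' /d0' mxE; case: (split a) => i; rewrite mxE.
    by rewrite addrC; apply: homogM; [apply: homogX | apply: (gen_graded R)].
  by rewrite (ord1 i) eqxx mulr1n; apply: homogX.
- case=> [|[|j]] a b; rewrite /sh' /d'.
  + rewrite mxE; case: (split a) => i; rewrite mxE; case: (split b) => k.
    * by apply: ofdegE (syz_graded R i k); rewrite opprD addrACA subrr addr0.
    * by rewrite mxE; apply: homog0.
    * by rewrite (ord1 i); apply: hc.
    * by rewrite (ord1 i) (ord1 k) mxE eqxx mulr1n addrK; apply/homogN/homogX.
  + rewrite mxE; case: (split b) => k; last by rewrite mxE; apply: homog0.
    by apply: ofdegE (syz_graded R a k); rewrite opprD addrACA subrr addr0.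
  + by apply: ofdegE (syz_graded R a b); rewrite opprD addrACA subrr addr0.
- move=> f; split=> [[_ [f1 /(gen_span R)[w ->] <-] [_ /ideal_gen1[e ->] <-]]|[w ->]].
    by exists (row_mx w e%:M); rewrite [RHS]d0'E M00.
  have [{}w [e ->]] := splitR _ w; rewrite d0'E.
  exists ('X_[v] * (w *m d0) 0 0).
    by exists ((w *m d0) 0 0) => //; apply/(gen_span R); exists w.
  by exists (e 0 0 * 'X_[m]) => //; apply/ideal_gen1; exists (e 0 0).
- move=> u; have [{}u [e ->]] := splitR _ u.
  rewrite (mx11_scalar e); move: (e 0 0) => {}e; split=> [ue0|[w]].
    (* The last coordinate [e] of a syzygy lies in the colon ideal (vI : m), hence is some [x *
       'X_[p]]; adding [x *: c] to the other coordinates then gives a syzygy of [d0]. *)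
    have eu : e * 'X_[m] = 'X_[v] * - (u *m d0) 0 0.
      have := congr1 (fun A : 'M_1 => A 0 0) ue0; rewrite /= d0'E M00 [RHS]mxE.
      by move/eqP; rewrite addrC addr_eq0 mulrN => /eqP.
    have [|x ex] := colon e (- (u *m d0) 0 0) _ eu.
      by apply: (@submoduleN _ S^o) => //; apply/(gen_span R); exists u.
    have [w hw] : exists w, u + x *: c = w *m d 0%N.
      apply/(gen_exact R); rewrite [LHS]mx11_scalar; suff -> : ((u + x *: c) *m d0) 0 0 = 0.
        by rewrite raddf0.
      apply: (mulfI (X0 v)); rewrite mulr0 mulmxDl -scalemxAl mxE [in X in _ + X]mxE.
      by rewrite mulrDr mulrCA -pmE mulrA -ex eu -mulrDr subrr mulr0.
    exists (row_mx w (- x)%:M); rewrite /d' mul_row_block mulmx0 add0r.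
    by rewrite mul_scalar_mx -hw scaleNr addrK -scalar_mxM mulrNN ex.
  have [{}w [x ->]] := splitR _ w; rewrite /d' mul_row_block mulmx0 add0r.
  rewrite (mx11_scalar x); move: (x 0 0) => {}x.
  rewrite mul_scalar_mx -scalar_mxM => /eq_row_mx[-> ->].
  rewrite [LHS]mx11_scalar d0'E mulmxDl.
  have -> : w *m d 0%N *m d0 = 0 by apply/(gen_exact R); exists w.
  rewrite add0r -scalemxAl M00 [in X in X + _]mxE.
  by rewrite mulrCA -pmE mulrN mulNr mulrA subrr raddf0.
- case=> [|[|j]] u; last exact: (syz_exact R).
    have [{}u [e ->]] := splitR _ u.
    rewrite /d' mul_row_block mulmx0 add0r (mx11_scalar e); move: (e 0 0) => {}e.
    rewrite mul_scalar_mx -scalar_mxM mulrN; split=> [|[w]].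
      (* As ['X_[p]] is not a zero divisor, a second syzygy has last coordinate 0 and comes from the
         old resolution. *)
      rewrite -[RHS]row_mx0 => /eq_row_mx[ue /matrixP/(_ 0 0)/eqP].
      rewrite !mxE eqxx mulr1n oppr_eq0 mulf_eq0 (negbTE (X0 p)) orbF => /eqP e0.
      move: ue; rewrite e0 scale0r addr0 => /(syz_exact R)[w ->].
      by exists w; rewrite mul_mx_row mulmx0 raddf0.
    rewrite /d' mul_mx_row mulmx0 => /eq_row_mx[-> /matrixP/(_ 0 0)].
    rewrite !mxE eqxx mulr1n => ->; rewrite mul0r oppr0 scale0r addr0 raddf0.
    have -> : w *m d 1%N *m d 0%N = 0 by apply/(syz_exact R); exists w.
    by rewrite row_mx0.
  by rewrite /d' mul_mx_row mulmx0; split=> [|/(syz_exact R)->];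
    [rewrite -[RHS]row_mx0 => /eq_row_mx[/(syz_exact R)] | rewrite row_mx0].
- move=> a; rewrite /d0' mxE; case: (split a) => i; rewrite mxE.
    by apply: irrZ; apply: (gen_minimal R).
  by rewrite (ord1 i) eqxx mulr1n; apply: irrX.
- case=> [|[|j]] a b; rewrite /d'.
  + rewrite mxE; case: (split a) => i; rewrite mxE; case: (split b) => k.
    * exact: (syz_minimal R).
    * by rewrite mxE.
    * by rewrite (ord1 i).
    * by rewrite (ord1 i) (ord1 k) mxE eqxx mulr1n -mulN1r; apply/irrZ/irrX.
  + rewrite mxE; case: (split b) => k; last by rewrite mxE.
    exact: (syz_minimal R).
  + exact: (syz_minimal R).
Qed.

End Cone.

(** * Homogeneity and divisibility for monomials *)

Section MonomialIdeals.
Variables (K : fieldType) (n : nat).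
Local Notation S := {mpoly K[n]}.

Lemma monomial_ideal_graded (T : Type) (ms : T -> 'X_{1..n}) (d : int) (f : S) :
  ideal_gen [set 'X_[ms i] | i in setT] f ->
  ideal_gen [set 'X_[ms i] | i in setT] (hcomp d f).
Proof.
move=> [r [c [g [Bg ->]]]]; rewrite raddf_sum /=.
have /choice[i hi] x : exists i, 'X_[ms i] = g x.
  by have [i _ <-] := Bg x; exists i.
exists r, (fun k => hcomp (d - (mdeg (ms (i k)))%:Z) (c k)), g.
split=> [k|]; first by exists (i k).
apply: eq_bigr => k _; rewrite -hi.
by rewrite -(hcompM _ _ (homogX K (ms (i k)))) subrK.
Qed.

Lemma dvd_mpolyX (a : 'X_{1..n}) (f : S) :
  (exists g, f = g * 'X_[a]) <-> forall m, m \in msupp f -> (a <= m)%MM.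
Proof.
split=> [[g ->] m|af].
  by rewrite (perm_mem (msuppMX _ _)) => /mapP[m' _ ->]; apply: lem_addr.
exists (\sum_(m <- msupp f) f@_m *: 'X_[m - a]).
rewrite mulr_suml {1}(mpolyE f) big_seq [RHS]big_seq; apply: eq_bigr => m /af am.
by rewrite -scalerAl -mpolyXD submK.
Qed.

(** The monomials [a] and [m] share no variable, so on each monomial of the support the exponents
    required by [a] come from [f]. *)
Lemma dvd_mpolyX_mul (a m : 'X_{1..n}) (f : S) :
  (forall k, (0 < a k)%N -> m k = 0%N) ->
  (exists g, f * 'X_[m] = g * 'X_[a]) -> exists g, f = g * 'X_[a].
Proof.
move=> am /dvd_mpolyX hf; apply/dvd_mpolyX => m' fm'.
have /mnm_lepP le_a : (a <= m + m')%MM.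
  by apply: hf; rewrite (perm_mem (msuppMX _ _)) map_f.
apply/mnm_lepP => k; have := le_a k; rewrite mnmDE.
by case: (posnP (a k)) => [->//|/am->].
Qed.

End MonomialIdeals.

Theorem theorem1p3 (K : fieldType) (n : nat) (hn : (2 <= n)%N)
    (I : set {mpoly K[n]}) (q : nat) (ms : 'I_q -> 'X_{1..n})
    (hI : minimally_generated_by I ms)
    (hI_nonzero : I <> [set 0]) (hI_proper : I <> setT)
    (v : 'X_{1..n}) (hv : v <> 0%MM) :
  infinite_set [set m : 'X_{1..n} | forall j : nat,
    betti (ideal_add (ideal_scale 'X_[v] I) (ideal_gen [set 'X_[m]])) j =
    if ((j == 1) || (j == 2))%N && [forall i, ~~ (m <= v + ms i)%MM]
    then (betti I j + 1)%N else betti I j].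
Proof.
have IE := hI.1.
have sI : submodule (I : set {mpoly K[n]}^o) by rewrite IE; apply: ideal_gen_submodule.
have gI d f : I f -> I (hcomp d f) by rewrite IE; apply: monomial_ideal_graded.
have [r [sh [d0 [d R]]]] := ideal_resolution_exists sI gI hI_proper.
have [k vk] : exists k, (0 < v k)%N.
  apply: contrapT => vk; apply: hv; apply/mnmP => k; rewrite mnm0E.
  by apply/eqP; rewrite -leqn0 leqNgt; apply/negP => ?; apply: vk; exists k.
(* A second variable exists because [n] is at least 2; its exponent will make [m] large. *)
have [k' k'k] : exists k' : 'I_n, k' != k.
  have [->|k0] := eqVneq k (Ordinal (ltnW hn)); first by exists (Ordinal hn).
  by exists (Ordinal (ltnW hn)); rewrite eq_sym.
have [i0 _] : exists i0 : 'I_q, true.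
  case: q ms hI IE => [|q'] ms' _ IE; last by exists ord0.
  case: hI_nonzero; rewrite IE; apply/seteqP; split=> [_ [[|r'] [c [g [hg ->]]]]|f ->].
  - by rewrite big_ord0.
  - by case: (hg ord0) => -[].
  - by case: (ideal_gen_submodule [set ('X_[ms' i] : {mpoly K[n]}) | i in setT]).
(* The generator with the least exponent in [k] determines the power of that variable generating the
   colon ideal. *)
have {i0} [i0 i0min] : exists i0 : 'I_q, forall i, (ms i0 k <= ms i k)%N.
  by case: (arg_minnP (fun i => ms i k) (isT : xpredT i0)) => i _ hi; exists i => j; apply: hi.
(* Away from [k], the exponents exceed those of every product of [v] with a generator by more than
   [N]; the parameter [N] makes the degrees unbounded. *)
pose mm N : 'X_{1..n} := [multinom if i == k then 0%N
  else (N + mdeg v + \sum_i mdeg (ms i)).+1 | i < n].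
have mmk N : mm N k = 0%N by rewrite mnmE eqxx.
have mmi N i l : l != k -> ((v + ms i)%MM l + N < mm N l)%N.
  move=> lk; rewrite [mm N l]mnmE (negbTE lk) ltnS mnmDE addnC -addnA leq_add2l leq_add //.
    by rewrite mdegE (bigD1 l) //= leq_addr.
  by rewrite (bigD1 i) //= mdegE (bigD1 l) //= -addnA leq_addr.
pose p : 'X_{1..n} := (U_(k) *+ (v k + ms i0 k))%MM.
have pE l : p l = if l == k then (v k + ms i0 k)%N else 0%N.
  by rewrite mulmnE mnm1E eq_sym; case: eqP; rewrite ?mul1n.
suff bettiE N : [set m : 'X_{1..n} | forall j : nat,
    betti (ideal_add (ideal_scale 'X_[v] I) (ideal_gen [set 'X_[m]])) j =
    if ((j == 1) || (j == 2))%N && [forall i, ~~ (m <= v + ms i)%MM]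
    then (betti I j + 1)%N else betti I j] (mm N).
  (* Were the set finite, [N] would bound the degrees of all its elements, yet [mm N] has degree
     greater than [N]. *)
  move=> /finite_seqP[s sE]; pose N := (\sum_(m <- s) mdeg m)%N.
  have : mm N \in s by have := bettiE N; rewrite sE.
  have leN m : m \in s -> (mdeg m <= N)%N by move=> sm; rewrite /N (big_rem _ sm) leq_addr.
  move=> /leN.
  rewrite leqNgt mdegE (bigD1 k') //= ltn_addr //.
  by apply: leq_ltn_trans (mmi N i0 k' k'k); apply: leq_addl.
(* The cofactor of [v + ms i0] in [p + mm N]; its positive exponent at [k'] will make the lift [c]
   minimal. *)
pose t : 'X_{1..n} := (p + mm N - (v + ms i0))%MM.
have vt : (v + ms i0 + t = p + mm N)%MM.
  rewrite addmC /t submK //; apply/mnm_lepP => l; rewrite [(p + _)%MM l]mnmDE pE.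
  have [->|lk] := eqVneq l k; first by rewrite mmk addn0 mnmDE.
  by rewrite add0n; apply/ltnW/(leq_ltn_trans _ (mmi N i0 l lk))/leq_addr.
have neq0 (m : 'X_{1..n}) l : (0 < m l)%N -> m != 0%MM.
  by apply: contraTN => /eqP->; rewrite mnm0E.
have p0 : p != 0%MM by apply: (neq0 _ k); rewrite pE eqxx ltn_addr.
have m0 : mm N != 0%MM by apply: (neq0 _ k'); apply: leq_ltn_trans (mmi N i0 k' k'k).
have t0 : t != 0%MM.
  apply: (neq0 _ k'); rewrite mnmBE subn_gt0 [(p + _)%MM k']mnmDE ltn_addl //.
  exact: leq_ltn_trans (leq_addr N _) (mmi N i0 k' k'k).
have Ims i : I 'X_[ms i] by rewrite IE; apply: mem_ideal_gen; exists i.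
have [w hw] := (gen_span R _).1 (Ims i0).
(* Only the homogeneous parts of the right degrees are kept from the coefficients [w], so that the
   lift is graded. *)
pose c0 : 'rV_(r 0%N) := \row_b hcomp ((mdeg (ms i0))%:Z - sh 0%N b) (w 0 b).
have c0E : (c0 *m d0) 0 0 = 'X_[ms i0].
  rewrite -[RHS](hcomp_id (homogX K (ms i0))) hw !mxE raddf_sum.
  apply: eq_bigr => b _; rewrite mxE -(hcompM _ _ (gen_graded R b)).
  by rewrite subrK.
have [||||sh' [d0' [d' R']]] := cone_resolution (v := v) (c := 'X_[t] *: c0) sI R m0 p0.
- by rewrite -scalemxAl mxE c0E -!mpolyXD -vt -addmA [(ms i0 + t)%MM]addmC.
- move=> b; rewrite [X in X - _](_ : _ = (mdeg v)%:Z + ((mdeg t)%:Z + (mdeg (ms i0))%:Z)).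
    rewrite [sh 0%N b + _]addrC opprD addrACA subrr add0r -addrA !mxE.
    by apply: homogM; [apply: homogX | apply: hcomp_homog].
  by rewrite -!PoszD -!mdegD -vt -addmA [(ms i0 + t)%MM]addmC.
- move=> b; apply/irrelevantP; rewrite !mxE rmorphM /= mcoeffX (negbTE t0).
  by rewrite mul0r.
(* By the choice of [i0], ['X_[p]] divides ['X_[v]] times each generator, hence [u * 'X_[mm N]]. As
   [mm N] is free of the variable [k], it divides [u]. *)
- move=> u f If uf; apply: (dvd_mpolyX_mul (m := mm N)).
    by move=> l; rewrite pE; case: eqP => // ->.
  move: If; rewrite uf IE => -[s [c [g [hg ->]]]].
  have /choice[h hh] x : exists h, 'X_[v] * g x = h * 'X_[p].
    have [i _ <-] := hg x; exists 'X_[v + ms i - p]; rewrite -!mpolyXD submK //.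
    apply/mnm_lepP => l; rewrite pE; case: eqP => // ->.
    by rewrite mnmDE leq_add2l.
  exists (\sum_x c x * h x); rewrite mulr_sumr mulr_suml; apply: eq_bigr => x _.
  by rewrite mulrCA hh mulrA.
have sJ := ideal_add_submodule (ideal_scale_submodule 'X_[v] sI)
  (ideal_gen_submodule [set 'X_[mm N]]).
(* The non-divisibility condition always holds for these monomials: the exponent of [mm N] at [k']
   is too large. *)
move=> j /=; have -> : [forall i, ~~ (mm N <= v + ms i)%MM].
  apply/forallP => i; apply/negP => /mnm_lepP/(_ k').
  by rewrite leqNgt (leq_ltn_trans (leq_addr N _) (mmi N i k' k'k)).
rewrite (betti_ideal_resolution sJ R') (betti_ideal_resolution sI R).
by case: j => [|[|[|j]]].
Qed.
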